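(* Let $\Gamma$ be a finite abelian group of order $m$ (written additively) and let $H\subseteq\Gamma$ be an aperiodic generating set of $\Gamma$. Fix a probability distribution on $H$ giving every element of $H$ positive probability; for each $n$ let $N=\{1,\dots,n\}$ and let $\omega(x)$, $x\in N$, be i.i.d. $H$-valued random variables with this distribution, and $\omega(A)=\sum_{x\in A}\omega(x)$ for $A\subseteq N$. Let $\Pi$ be a fixed Cayley poset with $\ell$ distinct elements $(\gamma_1,j_1),\dots,(\gamma_\ell,j_\ell)$ that is strongly diamond-free, and let $$\mathcal{F}(N,\omega,\Pi)=\bigcup_{i=1}^{\ell}\{A\subseteq N: |A|=\lfloor n/2\rfloor+j_i,\ \omega(A)=\gamma_i\}.$$ Then $$\frac{\ell}{m}=\lim_{n\to\infty}\frac{\mathrm{E}[|\mathcal{F}(N,\omega,\Pi)|]}{\binom{n}{\lfloor n/2\rfloor}}\le\liminf_{n\to\infty}\frac{La(n,D_2)}{\binom{n}{\lfloor n/2\rfloor}}.$$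
   Context: $La(n,D_2)$ is the maximum size of a family of subsets of $\{1,\dots,n\}$ that is diamond-free, i.e. contains no four distinct sets $A,B,C,D$ with $A\subseteq B\subseteq D$ and $A\subseteq C\subseteq D$. $H$ is aperiodic if the gcd of $\{\ell\ge1:\exists\,\eta_1,\dots,\eta_\ell\in H,\ \eta_1+\dots+\eta_\ell=0\}$ is $1$. Infinite Cayley poset $P(\Gamma,H)$: elements are pairs $(\gamma,i)$, $\gamma\in\Gamma$, $i\in\mathbb{Z}$, with $(\gamma,i)\preceq(\delta,j)$ iff $j\ge i$ and $\delta=\gamma+\eta'_1+\dots+\eta'_{j-i}$ for some $\eta'_k\in H$; a Cayley poset is a finite subset of it with the induced order. A Cayley poset is diamond-free if it has no four distinct elements $a,b,c,d$ with $a\preceq b\preceq d$, $a\preceq c\preceq d$. Three distinct elements $(\gamma_1,i_1)\prec(\gamma_2,i_2)\prec(\gamma_3,i_3)$ form a strong chain if some $\eta\in H$ occurs as a term both in some representation of $\gamma_2-\gamma_1$ as a sum of $i_2-i_1$ elements of $H$ and in some representation of $\gamma_3-\gamma_2$ as a sum of $i_3-i_2$ elements of $H$. A Cayley poset is strongly diamond-free if it is diamond-free and has no strong chain. *)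

(* Defs.v *)
From HB Require Import structures.
From mathcomp Require Import all_boot all_order all_algebra all_fingroup.
From mathcomp Require Import finmap.
From mathcomp Require Import all_classical all_reals all_analysis.

Set Implicit Arguments.
Unset Strict Implicit.
Unset Printing Implicit Defensive.

Import Order.TTheory GRing.Theory Num.Theory.
Import numFieldNormedType.Exports.

Local Open Scope ring_scope.

Section Diamonds.

(* The pattern is weak: [b] and [c] may be comparable, so a chain of four
   elements also counts as a diamond. *)
Definition diamond_free (T : eqType) (le : T -> T -> Prop) (S : {pred T}) :
    Prop :=
  ~ exists a b c d : T,
      [/\ [/\ a \in S, b \in S, c \in S & d \in S],
          uniq [:: a; b; c; d],
          le a b /\ le b d
        & le a c /\ le c d].

Definition La_diamond (n : nat) : nat :=
  \max_(F : {set {set 'I_n}} |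
        `[< diamond_free (fun A B : {set 'I_n} => A \subset B) (mem F) >]) #|F|.

End Diamonds.

Section CayleyPosets.
Variables (G : finZmodType) (H : {set G}).

Definition is_representation (k : nat) (g : G) (s : seq G) : Prop :=
  [/\ size s = k, {subset s <= H} & \sum_(h <- s) h = g].

Definition is_gcd_of (S : nat -> Prop) (g : nat) : Prop :=
  (forall l, S l -> (g %| l)%N) /\
  (forall d, (forall l, S l -> (d %| l)%N) -> (d %| g)%N).

Definition aperiodic : Prop :=
  is_gcd_of (fun l => (1 <= l)%N /\ exists s, is_representation l 0 s) 1.

Definition cayley_le (u v : G * int) : Prop :=
  u.2 <= v.2 /\ exists s, is_representation `|v.2 - u.2|%N (v.1 - u.1) s.

Definition strong_chain (u v w : G * int) : Prop :=
  [/\ uniq [:: u; v; w],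
      cayley_le u v,
      cayley_le v w
    & exists2 h : G, h \in H &
        (exists2 s, is_representation `|v.2 - u.2|%N (v.1 - u.1) s & h \in s) /\
        (exists2 s, is_representation `|w.2 - v.2|%N (w.1 - v.1) s & h \in s)].

Definition strongly_diamond_free (Pi : {fset G * int}) : Prop :=
  diamond_free cayley_le (mem Pi) /\
  ~ exists u v w : G * int,
      [/\ u \in Pi, v \in Pi, w \in Pi & strong_chain u v w].

End CayleyPosets.

Definition cayley_family (G : finZmodType) (n : nat) (w : 'I_n -> G)
    (Pi : {fset G * int}) : {set {set 'I_n}} :=
  (\bigcup_(p <- Pi)
     [set A : {set 'I_n} |
       ((#|A|%:Z == (n./2)%:Z + p.2) && (\sum_(x in A) w x == p.1))%R])%SET.

Section IID.
Local Open Scope classical_set_scope.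
Local Open Scope ereal_scope.
Context {R : realType} {d : measure_display} {T : measurableType d}.
Variables (P : probability T R) (G : finType).

(* Only singletons of [G] are mentioned for measurability: [G] is finite and
   carries the discrete sigma-algebra. *)
Definition discrete_random_variable (X : T -> G) : Prop :=
  forall g : G, measurable (X @^-1` [set g]).

Definition mutually_independent (I : finType) (X : I -> T -> G) : Prop :=
  forall (J : {set I}) (B : I -> set G),
    P (\bigcap_(x in [set` J]) (X x @^-1` B x)) =
    \prod_(x in J) P (X x @^-1` B x).

Definition iid_with_law (H : {set G}) (p : G -> R) (I : finType)
    (X : I -> T -> G) : Prop :=
  [/\ forall x, discrete_random_variable (X x),
      forall x t, X x t \in H,
      forall x h, h \in H -> P (X x @^-1` [set h]) = (p h)%:E
    & mutually_independent X].

End IID.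

(* Main.v *)
(* Every realisation of the random family is diamond-free: each of its sets
   has a label (weight, level) in Pi, inclusions give order relations between
   labels, and a diamond whose two middle sets share a label
   produces a strong chain. So the expected size of the family is at most
   La(n, D_2). By independence the weight of a k-set is distributed as the
   k-fold convolution power of the law on H; aperiodicity and generation make
   some power positive everywhere, hence the powers converge to the uniform law
   on G. Since the layers at bounded distance from the middle all have
   asymptotically the size of the middle one, each of the elements of Pi
   contributes 1 / #|G| to the limit. *)
Require Import Defs.
From HB Require Import structures.
From mathcomp Require Import all_boot all_order all_algebra all_fingroup.
From mathcomp Require Import finmap.
From mathcomp Require Import all_classical all_reals all_analysis.
From mathcomp Require Import cyclic measurable_realfun.
From mathcomp Require Import zify lra.

Set Implicit Arguments.
Unset Strict Implicit.
Unset Printing Implicit Defensive.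

Import Order.TTheory GRing.Theory Num.Theory.
Import numFieldNormedType.Exports.

Local Open Scope classical_set_scope.
Local Open Scope ring_scope.

(** * Sums of a prescribed number of generators *)

Section SumsOfGenerators.
Variables (G : finZmodType) (H : {set G}).

Definition is_sum_of (k : nat) (g : G) : Prop :=
  exists s, is_representation H k g s.

Lemma is_sum_of0 : is_sum_of 0 0.
Proof. by exists [::]; split=> //; rewrite big_nil. Qed.

Lemma is_sum_ofD k l g h :
  is_sum_of k g -> is_sum_of l h -> is_sum_of (k + l) (g + h).
Proof.
move=> [s [ss sH sg]] [t [st tH th]]; exists (s ++ t); split.
- by rewrite size_cat ss st.
- by move=> x; rewrite mem_cat => /orP[/sH|/tH].
- by rewrite big_cat /= sg th.
Qed.

Lemma is_sum_ofMn k g c : is_sum_of k g -> is_sum_of (k * c) (g *+ c).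
Proof.
move=> kg; elim: c => [|c ih]; first by rewrite muln0 mulr0n; exact: is_sum_of0.
by rewrite mulnS mulrS; exact: is_sum_ofD.
Qed.

(** By Lagrange, [h] repeated [#|G|] times sums to zero. Such blocks lengthen a representation
    without changing its sum. *)
Lemma is_sum_of_card h : h \in H -> is_sum_of #|G| 0.
Proof.
move=> hH; rewrite -[X in is_sum_of _ X](_ : h *+ #|G| = 0).
  rewrite -[X in is_sum_of X _]mul1n; apply: is_sum_ofMn; exists [:: h].
  by split=> //; [move=> x; rewrite inE => /eqP->|rewrite big_seq1].
by rewrite -FinRing.zmodXgE -cardsT expg_cardG ?inE.
Qed.

Lemma generated_is_sum_of : <<H>>%g = [set: G]%SET ->
  forall g, exists k, is_sum_of k g.
Proof.
move=> HG g; have : g \in <<H>>%g by rewrite HG inE.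
case/gen_prodgP => n [c cH ->]; exists n, [seq c i | i <- enum 'I_n]; split.
- by rewrite size_map size_enum_ord.
- by move=> x /mapP[i _ ->].
- by rewrite big_map big_enum.
Qed.

(* The lengths of zero-sum sequences form a subgroup modulo [#|G|]; its least
   positive element divides all of them. *)
Lemma aperiodic_length_eq1 h : h \in H -> aperiodic H ->
  exists2 l, is_sum_of l 0 & l = 1 %[mod #|G|].
Proof.
move=> hH [_ gcd1].
pose D d := (0 < d)%N && `[< exists2 l, is_sum_of l 0 & l = d %[mod #|G|] >].
have G0 : (0 < #|G|)%N by apply/card_gt0P; exists 0.
have exD : exists d, D d.
  exists #|G|; rewrite /D G0; apply/asboolP; exists #|G| => //.
  exact: (is_sum_of_card hH).
case: (ex_minnP exD) => d /andP[d0 /asboolP[l l0 ld]] dmin.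
suff d1 : (d %| 1)%N by move: d1 ld; rewrite dvdn1 => /eqP-> ?; exists l.
apply: gcd1 => k [_ k0]; rewrite /dvdn; apply: contraT; rewrite -lt0n => r0.
have /dmin : D (k %% d)%N.
  (* The factor [#|G|.-1] plays the role of -1 modulo [#|G|], so this length is congruent to
     [k - (k %/ d) * d], the remainder of [k] by [d]. *)
  rewrite /D r0; apply/asboolP; exists (k + l * ((k %/ d) * (#|G|.-1)))%N.
    rewrite -[0]addr0; apply: is_sum_ofD => //.
    by rewrite -(mul0rn _ ((k %/ d) * (#|G|.-1))); exact: is_sum_ofMn.
  rewrite -modnDmr -modnMml ld modnMml modnDmr {1}(divn_eq k d).
  rewrite (_ : (_ + _ = k %% d + (k %/ d * d) * #|G|)%N) ?modnMDl; last first.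
    rewrite -{2}(prednK G0); lia.
  by rewrite addnC modnMDl.
by rewrite leqNgt ltn_mod d0.
Qed.

(** A representation of [g] of length [k], followed by [k * #|G|.-1] zero-sum blocks of length 1
    modulo [#|G|], has length divisible by [#|G|]. Zero-sum blocks of length [#|G|] then bring all
    these lengths to a common value. *)
Lemma aperiodic_sums_exhaust h : h \in H -> aperiodic H ->
  <<H>>%g = [set: G]%SET -> exists2 K, (0 < K)%N & forall g, is_sum_of K g.
Proof.
move=> hH Hap HG; have [l l0 l1] := aperiodic_length_eq1 hH Hap.
have G0 : (0 < #|G|)%N by apply/card_gt0P; exists 0.
have /choice[K KP] : forall g, exists k, is_sum_of (#|G| * k)%N g.
  move=> g; have [k kg] := generated_is_sum_of HG g.
  have : (#|G| %| k + l * (k * #|G|.-1))%N.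
    rewrite /dvdn -modnDmr -modnMml l1 modnMml modnDmr mul1n.
    by rewrite -mulnS prednK// modnMl.
  case/dvdnP => c ec; exists c; rewrite mulnC -ec -[g]addr0.
  apply: is_sum_ofD => //.
  by rewrite -(mul0rn _ (k * #|G|.-1)); exact: is_sum_ofMn.
(* The sum dominates every [K g], and the successor keeps the common length positive. *)
exists (#|G| * (\sum_g K g).+1)%N => [|g]; first by rewrite muln_gt0 G0.
rewrite -addn1 (bigD1 g)//= -addnA mulnDr -[X in is_sum_of _ X]addr0.
apply: is_sum_ofD; first exact: KP.
rewrite -(mul0rn _ (\sum_(i | i != g) K i + 1)); apply: is_sum_ofMn.
exact: is_sum_of_card hH.
Qed.

End SumsOfGenerators.

(** * Convolution powers and their convergence to the uniform law *)

Section ConvolutionPowers.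
Variables (R : realType) (G : finZmodType) (mu : G -> R).

Fixpoint conv_pow (k : nat) (g : G) : R :=
  if k is k'.+1 then \sum_h mu h * conv_pow k' (g - h) else (g == 0)%:R.

Lemma conv_powD k l g :
  conv_pow (k + l) g = \sum_h conv_pow k h * conv_pow l (g - h).
Proof.
elim: k g => [|k ih] g /=.
  rewrite add0n (bigD1 0)//= eqxx mul1r subr0 big1 ?addr0// => h /negbTE->.
  by rewrite mul0r.
under eq_bigr do rewrite ih big_distrr/=.
under [RHS]eq_bigr do rewrite big_distrl/=.
rewrite [RHS]exchange_big/=; apply: eq_bigr => h _.
rewrite [RHS](reindex_inj (addIr h))/=; apply: eq_bigr => u _.
by rewrite addrK mulrA opprD addrA addrAC.
Qed.

Hypotheses (mu_ge0 : forall g, 0 <= mu g) (mu_sum1 : \sum_g mu g = 1).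

Lemma conv_pow_ge0 k g : 0 <= conv_pow k g.
Proof.
elim: k g => [|k ih] g /=; first exact: ler0n.
by rewrite sumr_ge0// => h _; rewrite mulr_ge0.
Qed.

Lemma sum_conv_pow k : \sum_g conv_pow k g = 1.
Proof.
elim: k => [|k ih] /=.
  by rewrite (bigD1 0)//= eqxx big1 ?addr0// => h /negbTE->.
rewrite exchange_big/= -[RHS]mu_sum1; apply: eq_bigr => h _.
rewrite -big_distrr/= (reindex_inj (addIr h))/=.
by under eq_bigr do rewrite addrK; rewrite ih mulr1.
Qed.

(** The path [s] alone already has positive mass: at each convolution only the term of the head of
    [s] is kept, the others being nonnegative. *)
Lemma conv_pow_gt0 (H : {set G}) k g : (forall h, h \in H -> 0 < mu h) ->
  is_sum_of H k g -> 0 < conv_pow k g.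
Proof.
move=> mu_gt0 [s [<- sH <-]]; elim: s sH => [|h s ih] sH /=.
  by rewrite big_nil eqxx.
rewrite big_cons (bigD1 h)//= addrAC subrr add0r ltr_pwDl//.
  rewrite mulr_gt0 ?mu_gt0 ?sH ?mem_head// ih// => x xs.
  by rewrite sH// inE xs orbT.
by rewrite sumr_ge0// => u _; rewrite mulr_ge0// conv_pow_ge0.
Qed.

Lemma card_zmod_neq0 : (#|G|%:R : R) != 0.
Proof. by rewrite pnatr_eq0 -lt0n; apply/card_gt0P; exists 0. Qed.

(* Subtracting [delta] from the kernel does not change its action on functions
   of mean zero, so Doeblin's minorisation gives a contraction in sup norm. *)
Lemma conv_pow_contract K delta k c :
  (forall g, delta <= conv_pow K g) ->
  (forall g, `|conv_pow k g - #|G|%:R^-1| <= c) ->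
  forall g, `|conv_pow (K + k) g - #|G|%:R^-1| <= (1 - #|G|%:R * delta) * c.
Proof.
move=> Kdelta kc g; pose u h := conv_pow k h - #|G|%:R^-1.
have u0 : \sum_h u (g - h) = 0.
  rewrite (reindex_inj (inv_inj (@opprK G)))/= (reindex_inj (addIr (- g)))/=.
  under eq_bigr do rewrite opprK addrC subrK.
  rewrite big_split/= sum_conv_pow sumr_const mulNrn.
  by rewrite -[X in _ - X]mulr_natl divff ?subrr// card_zmod_neq0.
have -> : conv_pow (K + k) g - #|G|%:R^-1 =
    \sum_h (conv_pow K h - delta) * u (g - h).
  under eq_bigr do rewrite mulrBl.
  rewrite sumrB -big_distrr/= u0 mulr0 subr0 conv_powD.
  under [RHS]eq_bigr do rewrite mulrBr.
  by rewrite sumrB -big_distrl/= sum_conv_pow mul1r.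
(* The contraction factor is the total mass of the nonnegative kernel [conv_pow K h - delta]. *)
have -> : (1 - #|G|%:R * delta) * c = \sum_h (conv_pow K h - delta) * c.
  by rewrite -big_distrl/= sumrB sum_conv_pow sumr_const mulr_natl.
apply: (le_trans (ler_norm_sum _ _ _)); apply: ler_sum => h _.
have K0 : 0 <= conv_pow K h - delta by rewrite subr_ge0.
by rewrite normrM ger0_norm// ler_wpM2l// kc.
Qed.

Lemma conv_pow_dist_le1 k g : `|conv_pow k g - #|G|%:R^-1| <= 1.
Proof.
have c1 : conv_pow k g <= 1.
  rewrite -(sum_conv_pow k) (bigD1 g)//= lerDl sumr_ge0// => h _.
  exact: conv_pow_ge0.
have c0 := conv_pow_ge0 k g.
have m1 : (#|G|%:R : R)^-1 <= 1.
  have G0 : (0 < #|G|)%N by apply/card_gt0P; exists 0.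
  by rewrite invf_le1 ?ler1n ?ltr0n.
have m0 : 0 <= (#|G|%:R : R)^-1 by rewrite invr_ge0.
by rewrite ler_norml; apply/andP; split; lra.
Qed.

(** Each full block of [K] steps contracts once; the remaining [k %% K] steps only enter through the
    trivial bound 1. *)
Lemma conv_pow_geometric K delta k g : (forall g, delta <= conv_pow K g) ->
  `|conv_pow k g - #|G|%:R^-1| <= (1 - #|G|%:R * delta) ^+ (k %/ K).
Proof.
move=> Kdelta; rewrite {1}(divn_eq k K).
elim: (k %/ K)%N g => [|q ih] g; last first.
  by rewrite mulSn exprS -addnA; exact: conv_pow_contract.
by rewrite mul0n add0n expr0 conv_pow_dist_le1.
Qed.

Lemma conv_pow_cvg (H : {set G}) : (exists h, h \in H) ->
  (forall h, h \in H -> 0 < mu h) -> aperiodic H -> <<H>>%g = [set: G]%SET ->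
  forall g, (fun k => conv_pow k g) @ \oo --> (#|G|%:R : R)^-1.
Proof.
move=> [h0 h0H] mu_gt0 Hap HG g.
have [K K0 Ksum] := aperiodic_sums_exhaust h0H Hap HG.
have Kgt0 h : 0 < conv_pow K h by exact: conv_pow_gt0 mu_gt0 (Ksum h).
(* A minimum of finitely many positive values, hence positive; the default 1 is harmless, since only
   a positive lower bound is wanted. *)
pose delta := \big[Num.min/1]_h conv_pow K h.
have delta_le h : delta <= conv_pow K h by exact: bigmin_le.
have delta_gt0 : 0 < delta by exact: lt_bigmin.
have m_gt0 : 0 < #|G|%:R :> R by rewrite ltr0n; apply/card_gt0P; exists 0.
have rho_ge0 : 0 <= 1 - #|G|%:R * delta.
  rewrite subr_ge0 -[leRHS](sum_conv_pow K) mulr_natl -sumr_const.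
  exact: ler_sum.
have rho_lt1 : `|1 - #|G|%:R * delta| < 1.
  by rewrite ger0_norm// gtrBl mulr_gt0.
have divK : (fun k => k %/ K)%N @ \oo --> \oo.
  apply/cvgnyPge => A; exists (A * K)%N => // n /=.
  by rewrite leq_divRL.
apply/subr_cvg0/norm_cvg0P.
apply: (@squeeze_cvgr _ _ _ _ (cst 0)
  (fun k => (1 - #|G|%:R * delta) ^+ (k %/ K))).
- by apply: nearW => k; rewrite normr_ge0 conv_pow_geometric.
- exact: cvg_cst.
- exact: cvg_comp divK (cvg_expr rho_lt1).
Qed.

End ConvolutionPowers.

(** * Laws of sums of i.i.d. group-valued variables *)

Section SumsOfIID.
Context {R : realType} {d : measure_display} {T : measurableType d}.
Variables (P : probability T R) (G : finZmodType) (H : {set G}) (p : G -> R).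

(** The values of [p] are prescribed only on [H]; extension by zero gives a law on all of [G], which
    can be convolved. *)
Definition law_on (h : G) : R := if h \in H then p h else 0.

Lemma law_on_ge0 h : (forall h, h \in H -> 0 < p h) -> 0 <= law_on h.
Proof. by move=> p_gt0; rewrite /law_on; case: ifP => // /p_gt0/ltW. Qed.

Lemma law_on_gt0 h : (forall h, h \in H -> 0 < p h) -> h \in H -> 0 < law_on h.
Proof. by move=> p_gt0 hH; rewrite /law_on hH p_gt0. Qed.

Lemma sum_law_on : \sum_h law_on h = \sum_(h in H) p h.
Proof. by rewrite [RHS]big_mkcond. Qed.

Variables (I : finType) (X : I -> T -> G).
Hypotheses (p_gt0 : forall h, h \in H -> 0 < p h).
Hypotheses (X_iid : iid_with_law P H p X).

Lemma iid_law x h : P (X x @^-1` [set h]) = (law_on h)%:E.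
Proof.
have [_ XH Xp _] := X_iid; rewrite /law_on.
case: ifPn => [|hH]; first exact: Xp.
rewrite (_ : _ @^-1` _ = set0) ?measure0//; apply/seteqP; split=> // t /= Xh.
by move: hH; rewrite -Xh XH.
Qed.

Lemma measurable_iid_preimage x (B : set G) : measurable (X x @^-1` B).
Proof.
have [mX _ _ _] := X_iid.
rewrite (_ : _ @^-1` _ = \bigcup_(g in B) (X x @^-1` [set g])).
  by apply: fin_bigcup_measurable => [|g _]; [exact: finite_finset|exact: mX].
apply/seteqP; split=> [t Bt|t [g Bg Xg]]; first by exists (X x t).
by rewrite /preimage/= Xg.
Qed.

Lemma measurable_iid_sum (s : seq I) g :
  measurable [set t | \sum_(x <- s) X x t = g].
Proof.
elim: s g => [|x s ih] g.
  have [<-|g0] := eqVneq 0 g.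
    rewrite (_ : mkset _ = setT)//; apply/seteqP; split=> // t _ /=.
    by rewrite big_nil.
  rewrite (_ : mkset _ = set0)//; apply/seteqP; split=> // t /=.
  by rewrite big_nil => /eqP; rewrite (negbTE g0).
rewrite (_ : mkset _ = \bigcup_(h in setT)
    (X x @^-1` [set h] `&` [set t | \sum_(x <- s) X x t = g - h])).
  apply: fin_bigcup_measurable => [|h _]; first exact: finite_finset.
  by apply: measurableI; [exact: measurable_iid_preimage|exact: ih].
apply/seteqP; split=> [t /=|t [h _ [/= <-]]]; rewrite big_cons => e.
  by exists (X x t) => //; split=> //=; rewrite -e addrAC subrr add0r.
by rewrite e addrC subrK.
Qed.

(* The factor over [J] makes the induction on [s] go through: conditioning on
   the value of the head of [s] moves that index into [J]. *)
Lemma iid_joint_sum (s : seq I) (J : {set I}) (B : I -> set G) g :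
  uniq s -> {in s, forall x, x \notin J} ->
  P (\bigcap_(x in [set` J]) (X x @^-1` B x) `&`
       [set t | \sum_(x <- s) X x t = g]) =
  (\prod_(x in J) P (X x @^-1` B x) * (conv_pow law_on (size s) g)%:E)%E.
Proof.
have [_ _ _ indep] := X_iid.
elim: s J B g => [|x s ih] J B g /=.
  move=> _ _; have [<-|g0] := eqVneq 0 g.
    rewrite (_ : [set t | \sum_(x <- [::]) X x t = 0] = setT).
      by rewrite setIT indep mule1.
    by apply/seteqP; split=> // t _ /=; rewrite big_nil.
  rewrite (_ : [set t | \sum_(x <- [::]) X x t = g] = set0).
    by rewrite setI0 measure0 mule0.
  apply/seteqP; split=> // t /=.
  by rewrite big_nil => /eqP; rewrite (negbTE g0).
move=> /andP[xs us] sJ.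
have xJ : x \notin J by apply: sJ; exact: mem_head.
(* [B' h] keeps the constraints on [J] and forces the head [x] to take the value [h]; the events
   [E h] partition the event under study. *)
pose B' h y := if y == x then [set h] else B y.
pose E h := \bigcap_(y in [set` x |: J]) (X y @^-1` B' h y) `&`
  [set t | \sum_(y <- s) X y t = g - h].
rewrite (_ : _ `&` _ = \bigcup_(h in [set` index_enum G]) E h); last first.
  apply/seteqP; split=> [t [Jt /= e]|t [h _ [JE /= e]]].
    exists (X x t); first exact: mem_index_enum.
    split=> [y /=|]; last first.
      by rewrite /= -e big_cons addrAC subrr add0r.
    rewrite !inE /B' => /orP[/eqP->|yJ]; first by rewrite eqxx.
    by case: eqP => [->//|_]; exact: Jt.
  have Xx : X x t = h by have /= := JE x; rewrite /B' eqxx !inE eqxx; apply.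
  split=> [y /= yJ|/=]; last by rewrite big_cons e Xx addrC subrK.
  have /= := JE y; rewrite !inE yJ orbT /B' => /(_ isT).
  by case: eqP yJ xJ => // -> ->.
rewrite measure_fin_bigcup//; first last.
- move=> h _; apply: measurableI; last exact: measurable_iid_sum.
  apply: fin_bigcap_measurable => [|y _]; first exact: finite_finset.
  exact: measurable_iid_preimage.
- move=> h h' _ _ [t [[+ _] [+ _]]] => /(_ x) /= + /(_ x) /=.
  by rewrite /B' eqxx !inE eqxx => /(_ isT) <- /(_ isT) <-.
rewrite -fsbig_seq ?index_enum_uniq// -sumEFin ge0_sume_distrr/=; last first.
  move=> h _; rewrite lee_fin mulr_ge0// ?law_on_ge0//.
  by apply: conv_pow_ge0 => u; exact: law_on_ge0.
apply: eq_bigr => h _; rewrite /E ih//; last first.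
  move=> y ys; rewrite !inE negb_or sJ ?inE ?ys ?orbT// andbT.
  by apply: contraNneq xs => <-.
rewrite big_setU1//= {1}/B' eqxx iid_law EFinM !muleA; congr (_ * _)%E.
rewrite muleC; congr (_ * _)%E; apply: eq_bigr => y yJ; rewrite /B'.
by case: eqP yJ xJ => // -> ->.
Qed.

(** The joint statement with [J] empty, where the product over [J] is 1. *)
Lemma iid_sum_law (A : {set I}) g :
  P [set t | \sum_(x in A) X x t = g] = (conv_pow law_on #|A| g)%:E.
Proof.
have := @iid_joint_sum (enum A) finset.set0 (fun=> setT) g (enum_uniq _).
rewrite big_set0 mul1e -cardE => <-; last by move=> x _; rewrite inE.
congr (P _); apply/seteqP; split=> t /=; rewrite big_enum//=; last by case.
Qed.

End SumsOfIID.

(** * The family of sets and its labels in the Cayley poset *)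

Section CayleyFamily.
Variables (G : finZmodType) (H : {set G}) (n : nat) (w : 'I_n -> G).

(* The only element of the infinite Cayley poset whose layer of the family
   can contain [A]. *)
Definition cayley_label (A : {set 'I_n}) : G * int :=
  (\sum_(x in A) w x, #|A|%:Z - n./2%:Z).

Lemma in_cayley_family (Pi : {fset G * int}) A :
  (A \in cayley_family w Pi) = (cayley_label A \in Pi).
Proof.
rewrite /cayley_family.
rewrite -[cayley_label A \in Pi]/(cayley_label A \in enum_fset Pi).
elim: (enum_fset Pi) => [|[g j] s ih]; first by rewrite big_nil inE.
rewrite big_cons !inE ih; congr (_ || _).
by rewrite xpair_eqE andbC subr_eq addrC.
Qed.

(** The count is exact: every set has a single label and [Pi] has no repetitions, so the pieces of
    the union are disjoint. *)
Lemma card_cayley_family (Pi : {fset G * int}) :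
  #|cayley_family w Pi| =
  (\sum_(u <- Pi) \sum_(A : {set 'I_n} | (#|A|%:Z == n./2%:Z + u.2)%R)
     (\sum_(x in A) w x == u.1)%R)%N.
Proof.
rewrite -sum1_card big_mkcond/=.
under [RHS]eq_bigr do rewrite big_mkcond/=.
rewrite exchange_big/=; apply: eq_bigr => A _.
rewrite in_cayley_family.
transitivity (nat_of_bool (cayley_label A \in enum_fset Pi)).
  by rewrite -[_ \in Pi]/(_ \in enum_fset Pi); case: ifP.
rewrite -(count_uniq_mem _ (fset_uniq Pi)) -sum1_count big_mkcond/=.
apply: eq_bigr => -[g j] _; rewrite xpair_eqE /= [_ == g]eq_sym [in RHS]addrC.
rewrite -[in RHS]subr_eq [in RHS](eq_sym _ j).
by case: (g == _); case: (j == _).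
Qed.

Hypothesis wH : forall x, w x \in H.

(** The list is explicit because a strong chain asks for a term common to two representations, not
    just for their existence. *)
Lemma cayley_label_representation (A B : {set 'I_n}) : A \subset B ->
  is_representation H `|(cayley_label B).2 - (cayley_label A).2|%N
    ((cayley_label B).1 - (cayley_label A).1) [seq w x | x <- enum (B :\: A)].
Proof.
move=> AB; have cAB := subset_leq_card AB; split.
- by rewrite size_map -cardE cardsD (finset.setIidPr AB) /=
    opprB addrA subrK subzn.
- by move=> _ /mapP[x _ ->].
- rewrite big_map big_enum/= [in RHS](big_setID A)/= (finset.setIidPr AB).
  by rewrite addrAC subrr add0r.
Qed.

Lemma cayley_label_le (A B : {set 'I_n}) : A \subset B ->
  cayley_le H (cayley_label A) (cayley_label B).
Proof.
move=> AB; split; last by eexists; exact: cayley_label_representation.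
by rewrite lerD2r lez_nat subset_leq_card.
Qed.

(** A proper inclusion raises the level, so the second coordinates already differ. *)
Lemma cayley_label_neq (A B : {set 'I_n}) : A \subset B -> A != B ->
  cayley_label A != cayley_label B.
Proof.
move=> AB; apply: contraNN; rewrite xpair_eqE => /andP[_].
rewrite (inj_eq (addIr _)) => /eqP[cAB].
by rewrite eqEcard AB cAB leqnn.
Qed.

(* If the two middle sets of a diamond have the same label, any element of one
   and not of the other contributes its weight to both gaps. *)
Lemma cayley_family_diamond_free (Pi : {fset G * int}) :
  strongly_diamond_free H Pi ->
  diamond_free (fun A B : {set 'I_n} => A \subset B) (mem (cayley_family w Pi)).
Proof.
move=> [Pi_df Pi_nsc] [A [B [C [D []]]]] [].
rewrite -![_ \in mem _]/(_ \in cayley_family w Pi) !in_cayley_family.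
move=> AP BP CP DP; rewrite /= !inE !negb_or !andbT.
move=> /and3P[/and3P[AnB AnC AnD] /andP[BnC BnD] CnD] [AB BD] [AC CD].
have nAB := cayley_label_neq AB AnB; have nAC := cayley_label_neq AC AnC.
have nBD := cayley_label_neq BD BnD; have nCD := cayley_label_neq CD CnD.
have nAD := cayley_label_neq (fintype.subset_trans AB BD) AnD.
have [eBC|nBC] := eqVneq (cayley_label B) (cayley_label C); last first.
  apply: Pi_df; exists (cayley_label A), (cayley_label B), (cayley_label C),
    (cayley_label D); split; rewrite ?inE//=.
  - by rewrite !inE !negb_or nAB nAC nAD nBC nBD nCD.
  - by split; exact: cayley_label_le.
  - by split; exact: cayley_label_le.
(* Equal labels give equal cardinalities, so an inclusion would force [B = C]. *)
have : ~~ (B \subset C).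
  apply: contra BnC => BC; rewrite eqEcard BC.
  by case: eBC => _ /(addIr _)[->] /=.
case/subsetPn => x xB xC; apply: Pi_nsc.
exists (cayley_label A), (cayley_label B), (cayley_label D); split=> //.
split; [by rewrite /= !inE !negb_or nAB nAD nBD|exact: cayley_label_le
  |exact: cayley_label_le|].
(* As [A] lies in [C] and [x] does not, [x] belongs to [B :\: A]. *)
exists (w x) => //; split.
  eexists; first exact: cayley_label_representation AB.
  rewrite map_f// mem_enum !inE xB andbT; apply: contraNN xC.
  exact: (fintype.subsetP AC).
(* Since [B] and [C] share a label, the second gap may be represented by [D :\: C], which contains
   [x], whereas [D :\: B] does not. *)
rewrite eBC; eexists; first exact: cayley_label_representation CD.
by rewrite map_f// mem_enum !inE xC (fintype.subsetP BD).
Qed.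

Lemma card_cayley_family_le (Pi : {fset G * int}) :
  strongly_diamond_free H Pi -> (#|cayley_family w Pi| <= La_diamond n)%N.
Proof.
move=> /cayley_family_diamond_free Fdf.
rewrite /La_diamond (bigD1 (cayley_family w Pi))/= ?leq_maxl//.
exact/asboolP.
Qed.

End CayleyFamily.

(** * Expected size of the random family *)

Section Expectation.
Context {R : realType} {d : measure_display} {T : measurableType d}.
Variables (P : probability T R) (G : finZmodType) (H : {set G}) (p : G -> R).
Variables (n : nat) (X : 'I_n -> T -> G).
Hypotheses (p_gt0 : forall h, h \in H -> 0 < p h).
Hypotheses (X_iid : iid_with_law P H p X).

Let E (A : {set 'I_n}) g := [set t | \sum_(x in A) X x t = g].

Let measurable_E A g : measurable (E A g).
Proof.
have := @measurable_iid_sum _ _ _ P G H p _ X X_iid (enum A) g.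
by under eq_set do rewrite big_enum/=.
Qed.

Let card_cayley_family_indic (Pi : {fset G * int}) t :
  (#|cayley_family (fun x => X x t) Pi|)%:R =
  \sum_(u <- Pi) \sum_(A : {set 'I_n} | #|A|%:Z == n./2%:Z + u.2)
    \1_(E A u.1) t :> R.
Proof.
rewrite card_cayley_family natr_sum; apply: eq_bigr => u _.
rewrite natr_sum; apply: eq_bigr => A _; rewrite indicE; congr (_%:R).
by congr nat_of_bool; apply/eqP/idP; rewrite in_setE.
Qed.

Let measurable_layer (j : int) g : measurable_fun setT (fun t =>
  \sum_(A : {set 'I_n} | #|A|%:Z == n./2%:Z + j) \1_(E A g) t : R).
Proof.
under eq_fun do rewrite -big_filter.
by apply: measurable_sum => A; exact: measurable_indic.
Qed.

Lemma measurable_card_cayley_family (Pi : {fset G * int}) :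
  measurable_fun setT
    (fun t => (#|cayley_family (fun x => X x t) Pi|)%:R : R).
Proof.
under eq_fun do rewrite card_cayley_family_indic.
by apply: measurable_sum => u; exact: measurable_layer.
Qed.

Lemma expectation_card_cayley_family (Pi : {fset G * int}) :
  ('E_P[fun t => (#|cayley_family (fun x => X x t) Pi|)%:R])%E =
  (\sum_(u <- Pi) \sum_(A : {set 'I_n} | #|A|%:Z == n./2%:Z + u.2)
     conv_pow (law_on H p) #|A| u.1)%:E.
Proof.
rewrite unlock -sumEFin.
under eq_integral do rewrite card_cayley_family_indic -sumEFin.
rewrite ge0_integral_sum//=; last 2 first.
- by move=> u; apply/measurable_EFinP; exact: measurable_layer.
- by move=> u t _; rewrite lee_fin sumr_ge0.
apply: eq_bigr => u _; rewrite -sumEFin.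
under eq_integral do rewrite -sumEFin -big_filter.
rewrite ge0_integral_sum//=; last first.
  by move=> A; apply/measurable_EFinP; exact: measurable_indic.
rewrite big_filter; apply: eq_bigr => A _.
by rewrite integral_indic// setIT -(iid_sum_law p_gt0 X_iid).
Qed.

Lemma expectation_card_cayley_family_le (Pi : {fset G * int}) :
  strongly_diamond_free H Pi ->
  ('E_P[fun t => (#|cayley_family (fun x => X x t) Pi|)%:R]
     <= (La_diamond n)%:R%:E)%E.
Proof.
move=> Pi_sdf; have [_ XH _ _] := X_iid.
(* The bound becomes the integral of a constant over a space of mass 1, so the pointwise inequality
   can be integrated. *)
rewrite unlock -[leRHS]mule1 -(probability_setT P) -integral_cst//.
apply: ge0_le_integral => //=.
- by apply/measurable_EFinP; exact: measurable_card_cayley_family.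
- by move=> t _; rewrite lee_fin ler_nat (card_cayley_family_le _ Pi_sdf).
Qed.

End Expectation.

(** * Lower limits and binomial coefficients near the middle layer *)

Section Asymptotics.
Variable R : realType.

Lemma le_limn_einf (u v : nat -> \bar R) :
  (forall n, (u n <= v n)%E) -> (limn_einf u <= limn_einf v)%E.
Proof.
move=> uv; rewrite !limn_einf_lim; apply: lee_lim; try exact: is_cvg_einfs.
apply: nearW => n; apply: le_ereal_inf_tmp => _ /= [k nk <-].
by apply: le_trans (uv k); apply: ereal_inf_lbound; exists k.
Qed.

Lemma near_half_ge N : \forall n \near \oo, (N <= n./2)%N.
Proof. by exists N.*2 => // n /=; rewrite geq_half_double. Qed.

(** The distance of the ratio to 1 is eventually at most [c / b n]. *)
Lemma ratio_cvg1 (c : nat) (a b : nat -> nat) : b @ \oo --> \oo ->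
  (\forall n \near \oo, (a n <= b n + c)%N && (b n <= a n + c)%N) ->
  (fun n => (a n)%:R / (b n)%:R : R) @ \oo --> (1 : R).
Proof.
move=> boo ab; apply/subr_cvg0/norm_cvg0P.
apply: (@squeeze_cvgr _ _ _ _ (cst 0) (fun n => c%:R * (b n)%:R^-1 : R)).
- near=> n; rewrite normr_ge0/=.
  have b0 : (0 < b n)%N by near: n; move/cvgnyPge : boo; exact.
  have bR : 0 < (b n)%:R :> R by rewrite ltr0n.
  rewrite -[X in _ - X](@divff _ (b n)%:R) ?gt_eqF// -mulrBl
    normrM normfV (gtr0_norm bR).
  rewrite ler_pM2r ?invr_gt0// ler_norml.
  have /andP[] : (a n <= b n + c)%N && (b n <= a n + c)%N by near: n.
  by rewrite -!(ler_nat R) !natrD => ? ?; apply/andP; split; lra.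
- exact: cvg_cst.
- rewrite -(mulr0 (c%:R : R)); apply: cvgM; first exact: cvg_cst.
  apply/gtr0_cvgV0; last exact/cvgrnyP.
  by move/cvgnyPge : boo => /(_ 1%N); apply: filterS => n; rewrite ltr0n.
Unshelve. all: by end_near. Qed.

(** One layer at a time: the quotient of adjacent binomial coefficients is a ratio of two integers
    close to [n./2] with bounded difference, hence tends to 1. *)
Lemma bin_ratio_near_half (j : int) :
  (fun n => 'C(n, `|(n./2%:Z + j)%R|%N)%:R / 'C(n, n./2)%:R : R) @ \oo -->
  (1 : R).
Proof.
have C0 n : ('C(n, n./2)%:R : R) != 0.
  by rewrite pnatr_eq0 -lt0n bin_gt0; lia.
have up (r : nat) :
  (fun n => 'C(n, n./2 + r)%:R / 'C(n, n./2)%:R : R) @ \oo --> (1 : R).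
  elim: r => [|r ih].
    rewrite (_ : (fun n => _) = cst 1); first exact: cvg_cst.
    by apply/funext => n; rewrite addn0 divff.
  have ratio : (fun n => (n - (n./2 + r))%:R / (n./2 + r).+1%:R : R) @ \oo -->
      (1 : R).
    apply: (@ratio_cvg1 (2 * r + 2)).
    - apply/cvgnyPge => A; have := near_half_ge A.
      by apply: filterS => n ?; lia.
    - near=> n; have : (r <= n./2)%N by near: n; exact: near_half_ge.
      lia.
  rewrite -[X in _ --> X](mulr1 1); apply: cvg_trans (cvgM ih ratio).
  apply: near_eq_cvg; near=> n; rewrite /= addnS.
  have -> : 'C(n, (n./2 + r).+1)%:R = 'C(n, n./2 + r)%:R *
      ((n - (n./2 + r))%:R / (n./2 + r).+1%:R) :> R.
    rewrite mulrA; apply: (canRL (mulfK _)); first by rewrite pnatr_eq0.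
    by rewrite -!natrM mulnC mul_bin_left mulnC.
  by rewrite mulrAC.
have down (r : nat) :
  (fun n => 'C(n, n./2 - r)%:R / 'C(n, n./2)%:R : R) @ \oo --> (1 : R).
  elim: r => [|r ih].
    rewrite (_ : (fun n => _) = cst 1); first exact: cvg_cst.
    by apply/funext => n; rewrite subn0 divff.
  have ratio : (fun n => (n./2 - r)%:R / (n - (n./2 - r.+1))%:R : R) @ \oo -->
      (1 : R).
    (* Once [r < n./2], the two integers differ by [2 * r + 1] for even [n] and by [2 * r + 2] for
       odd [n]. *)
    apply: (@ratio_cvg1 (2 * r + 2)).
    - apply/cvgnyPge => A; have := near_half_ge A.
      by apply: filterS => n ?; lia.
    - near=> n; have : (r < n./2)%N by near: n; exact: near_half_ge.
      lia.
  rewrite -[X in _ --> X](mulr1 1); apply: cvg_trans (cvgM ih ratio).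
  apply: near_eq_cvg; near=> n; rewrite /=.
  have rn : (r < n./2)%N by near: n; exact: near_half_ge.
  have nz : ((n - (n./2 - r.+1))%:R : R) != 0 by rewrite pnatr_eq0; lia.
  have -> : 'C(n, n./2 - r.+1)%:R = 'C(n, n./2 - r)%:R *
      ((n./2 - r)%:R / (n - (n./2 - r.+1))%:R) :> R.
    rewrite mulrA; apply: (canRL (mulfK nz)); rewrite -!natrM mulnC.
    by rewrite -mul_bin_left -subSn// subSS mulnC.
  by rewrite mulrAC.
case: (intP j) => [|r|r].
- by have := up 0%N; under eq_fun do rewrite addn0.
- exact: up r.+1.
(* For a negative shift, the absolute value and the truncated subtraction agree only once [n./2]
   exceeds [r]. *)
- apply: cvg_trans (down r.+1); apply: near_eq_cvg; near=> n.
  have rn : (r < n./2)%N by near: n; exact: near_half_ge.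
  by rewrite subzn.
Unshelve. all: by end_near. Qed.

End Asymptotics.

(** Nonnegativity of the level matters: at a negative level the left side is an empty sum, while the
    absolute value on the right may name a genuine layer. *)
Lemma sum_layer (R : realType) (n : nat) (j : int) (f : nat -> R) :
  0 <= n./2%:Z + j ->
  \sum_(A : {set 'I_n} | #|A|%:Z == n./2%:Z + j) f #|A| =
  'C(n, `|(n./2%:Z + j)%R|%N)%:R * f `|(n./2%:Z + j)%R|%N.
Proof.
move=> /gez0_abs; set k := `|_|%N => <-.
rewrite (eq_bigr (fun=> f k)) => [|A /eqP[->]//].
rewrite sumr_const mulr_natl -[in RHS](card_ord n) -card_draws.
by congr (_ *+ _); apply: eq_card => A; rewrite !inE.
Qed.

(** * The limit of the normalised expectation and the lower bound *)

Theorem theorem2 (R : realType) (G : finZmodType) (H : {set G})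
    (H_aperiodic : aperiodic H)
    (H_generates : <<H>>%g = [set: G]%SET)
    (p : G -> R)
    (p_gt0 : forall h, h \in H -> 0 < p h)
    (p_sum1 : \sum_(h in H) p h = 1)
    (d : nat -> measure_display)
    (T : forall n : nat, measurableType (d n))
    (P : forall n : nat, probability (T n) R)
    (w : forall n : nat, 'I_n -> T n -> G)
    (w_iid : forall n : nat, iid_with_law (P n) H p (w n))
    (Pi : {fset G * int})
    (Pi_sdf : strongly_diamond_free H Pi) :
  ((fun n : nat =>
      'E_(P n)[fun t => (#|cayley_family (fun x => w n x t) Pi|)%:R]
        * (('C(n, n./2)%:R)^-1)%:E)%E @ \oo
     --> ((#|` Pi|%:R / #|G|%:R : R)%:E))
  /\ (((#|` Pi|%:R / #|G|%:R : R)%:E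
      <= limn_einf (fun n : nat =>
           ((La_diamond n)%:R / 'C(n, n./2)%:R : R)%:E))%E).
Proof.
have [h hH] : exists h, h \in H.
  apply/set0Pn; apply: contra_eqN p_sum1 => /eqP->.
  by rewrite big_set0 eq_sym oner_eq0.
pose q := conv_pow (law_on H p).
have q_cvg g : (fun k => q k g) @ \oo --> (#|G|%:R : R)^-1.
  apply: (conv_pow_cvg _ _ _ _ H_aperiodic H_generates) => //.
  - by move=> u; exact: law_on_ge0.
  - by rewrite sum_law_on.
  - by exists h.
  - by move=> u; exact: law_on_gt0.
pose S (u : G * int) n :=
  \sum_(A : {set 'I_n} | #|A|%:Z == n./2%:Z + u.2) q #|A| u.1.
(* For large [n] the quotient is a binomial ratio tending to 1 times [q] at a level tending to
   infinity. *)
have S_cvg u : (fun n => S u n / 'C(n, n./2)%:R) @ \oo --> (#|G|%:R : R)^-1.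
  have koo : (fun n => `|(n./2%:Z + u.2)%R|%N) @ \oo --> \oo.
    apply/cvgnyPge => A; have := near_half_ge (A + `|u.2|%N).
    by apply: filterS => n; lia.
  have qk : (fun n => q `|(n./2%:Z + u.2)%R|%N u.1) @ \oo --> (#|G|%:R : R)^-1.
    exact: cvg_comp koo (q_cvg u.1).
  rewrite -[X in _ --> X]mul1r.
  apply: cvg_trans (cvgM (bin_ratio_near_half u.2) qk).
  apply: near_eq_cvg; near=> n.
  have hn : (`|u.2|%N <= n./2)%N by near: n; exact: near_half_ge.
  have j_ge : 0 <= n./2%:Z + u.2 by lia.
  have -> : S u n = _ := sum_layer (q^~ u.1) j_ge.
  by rewrite /= mulrAC.
have E_cvg : (fun n : nat =>
      'E_(P n)[fun t => (#|cayley_family (fun x => w n x t) Pi|)%:R]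
        * (('C(n, n./2)%:R)^-1)%:E)%E @ \oo
     --> ((#|` Pi|%:R / #|G|%:R : R)%:E).
  rewrite (_ : (fun n : nat => _) =
      (fun n => (\sum_(u <- Pi) S u n / 'C(n, n./2)%:R)%:E)); last first.
    apply/funext => n; rewrite (expectation_card_cayley_family p_gt0 (w_iid n)).
    by rewrite -EFinM big_distrl.
  apply: cvg_EFin; first exact: nearW.
  rewrite (_ : _ / _ = \sum_(u <- Pi) #|G|%:R^-1); last first.
    by rewrite big_const_seq count_predT iter_addr_0 mulr_natl.
  by apply: cvg_big => [|u _]; [exact: add_continuous|exact: S_cvg].
(* The limit just found is also the lower limit of the normalised expectations, so a termwise
   comparison with [La_diamond] suffices. *)
split=> //; rewrite -(cvg_lim _ E_cvg)// -is_cvg_limn_einfE; last first.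
  by apply/cvg_ex; eexists; exact: E_cvg.
apply: le_limn_einf => n; rewrite EFinM lee_wpmul2r ?lee_fin//.
exact: expectation_card_cayley_family_le (w_iid n) _ Pi_sdf.
Unshelve. all: by end_near. Qed.
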